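(* Let $R$ be a Dedekind domain with torsion class group that has the almost Dirichlet property and is power separated. Suppose that there are infinitely many prime ideals $P$ of $R$ such that the canonical map $U(R)\longrightarrow R/P^{n_P}$ is injective for some positive integer $n_P$. Then $\Lambda_1(R)$ is trivial and $\Lambda(R)\simeq U(R)$ (as groups).
   Context: All Dedekind domains are assumed not to be fields. $U(R)$ denotes the group of units of $R$. For an integral domain $R$ and $I\subseteq R$, put $I^\bullet := I\setminus\{0\}$. The Golomb space $G(R)$ is the set $R^\bullet$ with the topology generated by the coprime cosets of $R$, i.e. by the sets $x+I$ (as subsets of $R^\bullet$, i.e. $(x+I)\cap R^\bullet$) where $x\in R^\bullet$, $I$ is a nonzero ideal of $R$, and $\langle x, I\rangle = R$. For $A\subseteq R^\bullet$, $\overline{A}$ denotes the closure of $A$ in $G(R)$. An element $b\in R$ is almost prime if it is irreducible and is contained in a unique prime ideal. A Dedekind domain $R$ with torsion class group has the almost Dirichlet property if every coprime coset contains at least one almost prime element, i.e. the set of almost prime elements is dense in $G(R)$. For $a\in R$, $\mathrm{pow}(a):=\{ua^n\mid u\in U(R),\ n\geq 1\}$. For a maximal ideal $P$, $G_{\{P\}}(R)$ is the set of all nonzero $x\in R$ contained in $P$ and in no other prime ideal. A Dedekind domain $R$ with torsion class group is power separated if for every maximal ideal $P$ and every $b\in G_{\{P\}}(R)$ one has $\overline{\mathrm{pow}(b)}\cap G_{\{P\}}(R)=\mathrm{pow}(b)$. Let $\mathrm{Homeo}(G(R))$ be the group of self-homeomorphisms of $G(R)$; set $\Lambda(R):=\{h\in\mathrm{Homeo}(G(R))\mid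 h(P^\bullet)=P^\bullet \text{ for every } P\in\mathrm{Spec}(R)\}$ and $\Lambda_1(R):=\{h\in\Lambda(R)\mid h(1)=1\}$. *)

(* Defs.v *)
From HB Require Import structures.
From mathcomp Require Import all_boot all_order all_algebra.
From mathcomp Require Import all_classical topology.

Set Implicit Arguments.
Unset Strict Implicit.
Unset Printing Implicit Defensive.

Import GRing.Theory.

Local Open Scope classical_set_scope.
Local Open Scope ring_scope.

Section Ideals.
Context {R : idomainType}.
Implicit Types (I J P M : set R).

(* Ideals are arbitrary subsets of [R], the whole ring included, unlike the
   decidable and always proper ideals of [ring_quotient]. *)
Definition is_ideal I : Prop :=
  [/\ I 0,
      forall x y, I x -> I y -> I (x + y)
    & forall a x, I x -> I (a * x)].

Definition ideal_gen (A : set R) : set R := smallest is_ideal A.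

Definition ideal_mul I J : set R := ideal_gen [set x * y | x in I & y in J].

Definition ideal_exp I n : set R := iter n (ideal_mul I) setT.

Definition prime_ideal P : Prop :=
  [/\ is_ideal P, ~ P 1 & forall a b, P (a * b) -> P a \/ P b].

Definition maximal_ideal M : Prop :=
  [/\ is_ideal M, ~ M 1
    & forall J, is_ideal J -> M `<=` J -> J = M \/ J = setT].

(* The class of [a] in [R / I], as a subset of [R]. *)
Definition residue_class I (a : R) : set R := [set b | I (b - a)].

Definition irreducible (b : R) : Prop :=
  [/\ b != 0, b \isn't a GRing.unit
    & forall x y, b = x * y ->
        x \is a GRing.unit \/ y \is a GRing.unit].

Definition almost_prime (b : R) : Prop :=
  irreducible b /\ exists! P, prime_ideal P /\ P b.

Definition pow (a : R) : set R :=
  [set x | exists u n, [/\ u \is a GRing.unit, (0 < n)%N & x = u * a ^+ n]].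

End Ideals.

Section FractionalIdeals.
Context {R : idomainType}.
Local Notation K := {fraction R}.
Local Notation iota := (@tofrac R).
Implicit Types (J L : set K).

Definition is_submodule J : Prop :=
  [/\ J 0,
      forall x y, J x -> J y -> J (x + y)
    & forall (a : R) x, J x -> J (iota a * x)].

Definition fractional_ideal J : Prop :=
  [/\ is_submodule J, J <> [set 0]
    & exists2 d : R, d != 0 & forall x, J x -> range iota (iota d * x)].

Definition principal_fractional_ideal J : Prop :=
  exists2 z : K, z != 0 & J = [set iota a * z | a in setT].

Definition submodule_mul J L : set K :=
  smallest is_submodule [set x * y | x in J & y in L].

Definition submodule_exp J n : set K := iter n (submodule_mul J) (range iota).

End FractionalIdeals.

Section DedekindDomains.
Variable R : idomainType.

Definition noetherian : Prop :=
  forall I : set R, is_ideal I -> exists s : seq R, I = ideal_gen [set` s].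

Definition integrally_closed : Prop :=
  forall z : {fraction R}, integralOver (@tofrac R) z -> range (@tofrac R) z.

(* Fields are excluded by the last condition. *)
Definition dedekind_domain : Prop :=
  [/\ noetherian,
      integrally_closed,
      forall P : set R, prime_ideal P -> P <> [set 0] -> maximal_ideal P
    & exists2 a : R, a != 0 & a \isn't a GRing.unit].

(* Every element of the group of fractional ideals modulo the principal ones
   has finite order: some positive power of each fractional ideal is trivial
   in the quotient. *)
Definition torsion_class_group : Prop :=
  forall J : set {fraction R}, fractional_ideal J ->
    exists2 n, (0 < n)%N & principal_fractional_ideal (submodule_exp J n).

End DedekindDomains.

Definition golomb (R : idomainType) : Type := {x : R | x != 0}.

HB.instance Definition _ (R : idomainType) :=
  SubChoice.copy (golomb R) {x : R | x != 0}.

Section GolombSpace.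
Context {R : idomainType}.

(* [A \ {0}], as a set of points of the Golomb space. *)
Definition bullet (A : set R) : set (golomb R) := [set x | A (val x)].

Definition coprime_coset (C : set (golomb R)) : Prop :=
  exists (x : golomb R) (I : set R),
    [/\ is_ideal I, I <> [set 0], ideal_gen (val x |` I) = setT
      & C = bullet [set val x + i | i in I]].

HB.instance Definition _ :=
  @isSubBaseTopological.Build (golomb R) (set (golomb R)) coprime_coset id.

Definition golomb1 : golomb R := exist _ 1 (oner_neq0 R).

(* The nonzero elements lying in [P] and in no other prime ideal. *)
Definition golomb_at (P : set R) : set (golomb R) :=
  bullet [set x | P x /\ forall Q, prime_ideal Q -> Q x -> Q = P].

End GolombSpace.

Section GolombProperties.
Variable R : idomainType.

Definition almost_dirichlet : Prop :=
  forall C : set (golomb R), coprime_coset C ->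
    exists2 b, C b & almost_prime (val b).

Definition power_separated : Prop :=
  forall (P : set R) (b : golomb R), maximal_ideal P -> golomb_at P b ->
    closure (bullet (pow (val b))) `&` golomb_at P = bullet (pow (val b)).

End GolombProperties.

Record homeo (T : topologicalType) : Type := Homeo {
  homeo_fun :> T -> T;
  homeo_inv : T -> T;
  homeoK : cancel homeo_fun homeo_inv;
  homeo_invK : cancel homeo_inv homeo_fun;
  homeo_continuous : continuous homeo_fun;
  homeo_inv_continuous : continuous homeo_inv
}.

Section HomeoGroup.
Variable T : topologicalType.
Implicit Types f g h : homeo T.

HB.instance Definition _ := gen_eqMixin (homeo T).
HB.instance Definition _ := gen_choiceMixin (homeo T).

Lemma homeoP f g : f =1 g -> f = g.
Proof.
case: f g => [f f' fK f'K cf cf'] [g g' gK g'K cg cg'] /= fg.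
have efg : f = g by apply/funext.
move: fK f'K cf cf' fg; rewrite efg => fK f'K cf cf' _.
have efg' : f' = g' by apply/funext => x; apply: (can_inj gK); rewrite f'K g'K.
move: fK f'K cf'; rewrite efg' => fK f'K cf'.
by congr Homeo; apply: Prop_irrelevance.
Qed.

Definition homeo1 : homeo T :=
  @Homeo T id id (fun=> erefl) (fun=> erefl)
    (fun=> @cvg_id _ _) (fun=> @cvg_id _ _).

Definition homeoV f : homeo T :=
  Homeo (@homeo_invK T f) (@homeoK T f)
    (@homeo_inv_continuous T f) (@homeo_continuous T f).

Lemma comp_continuous (u v : T -> T) :
  continuous u -> continuous v -> continuous (u \o v).
Proof. by move=> cu cv x; apply: continuous_comp; [exact: cv|exact: cu]. Qed.

Definition homeoM f g : homeo T :=
  Homeo (can_comp (@homeoK T f) (@homeoK T g))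
    (can_comp (@homeo_invK T g) (@homeo_invK T f))
    (comp_continuous (@homeo_continuous T f) (@homeo_continuous T g))
    (comp_continuous (@homeo_inv_continuous T g) (@homeo_inv_continuous T f)).

Lemma homeoMA : associative homeoM. Proof. by move=> f g h; apply: homeoP. Qed.
Lemma homeo1M : left_id homeo1 homeoM. Proof. by move=> f; apply: homeoP. Qed.
Lemma homeoM1 : right_id homeo1 homeoM. Proof. by move=> f; apply: homeoP. Qed.
Lemma homeoVM : left_inverse homeo1 homeoV homeoM.
Proof. by move=> f; apply: homeoP => x /=; rewrite homeoK. Qed.
Lemma homeoMV : right_inverse homeo1 homeoV homeoM.
Proof. by move=> f; apply: homeoP => x /=; rewrite homeo_invK. Qed.

HB.instance Definition _ :=
  isGroup.Build (homeo T) homeoMA homeo1M homeoM1 homeoVM homeoMV.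

End HomeoGroup.

Section Lambda.
Variable R : idomainType.

Definition Lambda : set (homeo (golomb R)) :=
  [set h | forall P : set R, prime_ideal P -> h @` bullet P = bullet P].

Definition Lambda1 : set (homeo (golomb R)) :=
  [set h | Lambda h /\ h golomb1 = golomb1].

Lemma Lambda_group_closed : group_closed (fun h => h \in Lambda).
Proof.
split=> [|f g]; rewrite !unfold_in /= !inE; first by move=> P _; exact: image_id.
move=> Lf Lg P pP; rewrite -[RHS](Lf P pP) -{1}(Lg P pP) -image_comp.
congr (_ @` _); apply/seteqP; split=> x /=.
  by move=> [_ [y Py <-] <-]; rewrite homeoK.
by move=> Px; exists (g x); [exists x|rewrite homeoK].
Qed.

Definition Lambda_group : Type := {h : homeo (golomb R) | h \in Lambda}.

HB.instance Definition _ :=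
  SubChoice.copy Lambda_group {h : homeo (golomb R) | h \in Lambda}.
HB.instance Definition _ :=
  SubChoice_isSubGroup.Build _ _ Lambda_group Lambda_group_closed.

End Lambda.

Arguments Lambda R : clear implicits.
Arguments Lambda1 R : clear implicits.

Definition unit_group (R : idomainType) : Type :=
  {u : R | u \is a GRing.unit}.

Section UnitGroup.
Variable R : idomainType.
Local Notation U := (unit_group R).

HB.instance Definition _ := SubChoice.copy U {u : R | u \is a GRing.unit}.

Definition unit1 : U := exist _ 1 (unitr1 R).
Definition unitV (u : U) : U :=
  exist _ (val u)^-1 (etrans (unitrV (val u)) (valP u)).
Lemma unitM_subproof (u v : U) : val u * val v \is a GRing.unit.
Proof. by rewrite unitrM (valP u) (valP v). Qed.
Definition unitM (u v : U) : U := exist _ (val u * val v) (unitM_subproof u v).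

Lemma unitMA : associative unitM.
Proof. by move=> u v w; apply: val_inj; exact: mulrA. Qed.
Lemma unit1M : left_id unit1 unitM.
Proof. by move=> u; apply: val_inj; exact: mul1r. Qed.
Lemma unitM1 : right_id unit1 unitM.
Proof. by move=> u; apply: val_inj; exact: mulr1. Qed.
Lemma unitVM : left_inverse unit1 unitV unitM.
Proof. by move=> u; apply: val_inj; exact: mulVr (valP u). Qed.
Lemma unitMV : right_inverse unit1 unitV unitM.
Proof. by move=> u; apply: val_inj; exact: mulrV (valP u). Qed.

HB.instance Definition _ := isGroup.Build U unitMA unit1M unitM1 unitVM unitMV.

End UnitGroup.

Definition group_isomorphic (G H : groupType) : Prop :=
  exists f : {multiplicative G -> H}, bijective f.

(* Main.v *)
(* Let [h] be a homeomorphism preserving every prime ideal. For [y] in [pow b],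
   the point [h y] lies in the closure of [pow (h b)], because almost prime
   elements are dense and, for [c] almost prime in [P], [pow c] is the
   [h]-invariant set [G_{P}]. Power separation then forces [h c] to be a unit
   times [c] for every almost prime [c].

   Near a point [x], choose [Q] with [x] not in [Q] and [U(R) -> R / Q^n]
   injective: as [h c] is close to [h x] modulo [Q^n], the unit [h c / c] is
   determined, hence the same for all almost primes [c] near [x]; by density
   and the Hausdorff property [h] is the multiplication by a unit near [x].
   Any two nonempty open sets have intersecting closures, so this unit does
   not depend on [x]. *)
From HB Require Import structures.
Require Import Defs.
From mathcomp Require Import all_boot all_order all_algebra.
From mathcomp Require Import all_classical topology.
From mathcomp Require Import ring.

Set Implicit Arguments.
Unset Strict Implicit.
Unset Printing Implicit Defensive.

Import GRing.Theory.

Local Open Scope classical_set_scope.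
Local Open Scope ring_scope.

(** * Ideal arithmetic, comaximality and prime ideals *)

Section Ideals.
Context {R : idomainType}.
Implicit Types (I J P Q : set R) (a b r s x y : R).

Lemma ideal0 I : is_ideal I -> I 0. Proof. by case. Qed.

Lemma ideal_add I x y : is_ideal I -> I x -> I y -> I (x + y).
Proof. by case=> _ + _; apply. Qed.

Lemma ideal_mull I a x : is_ideal I -> I x -> I (a * x).
Proof. by case=> _ _; apply. Qed.

Lemma ideal_mulr I a x : is_ideal I -> I x -> I (x * a).
Proof. by rewrite mulrC; exact: ideal_mull. Qed.

Lemma ideal_sub I x y : is_ideal I -> I x -> I y -> I (x - y).
Proof. by move=> iI Ix Iy; rewrite -mulN1r; apply: ideal_add => //; exact: ideal_mull. Qed.

Lemma idealT I : is_ideal I -> I 1 -> I = setT.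
Proof.
by move=> iI I1; apply/seteqP; split=> // x _; rewrite -[x]mulr1; apply: ideal_mull.
Qed.

Lemma ideal_gen_ideal (A : set R) : is_ideal (ideal_gen A).
Proof.
split=> [B [iB _]|x y Ax Ay B BA|a x Ax B BA].
- exact: ideal0.
- by have [iB _] := BA; apply: ideal_add; [|exact: Ax|exact: Ay].
- by have [iB _] := BA; apply: ideal_mull; last exact: Ax.
Qed.

Lemma setT_ideal : is_ideal [set: R]. Proof. by []. Qed.

Lemma setI_ideal I J : is_ideal I -> is_ideal J -> is_ideal (I `&` J).
Proof.
move=> iI iJ; split=> [|x y [Ix Jx] [Iy Jy]|a x [Ix Jx]].
- by split; apply: ideal0.
- by split; apply: ideal_add.
- by split; apply: ideal_mull.
Qed.

Definition ideal_adjoin I a : set R := [set x | exists r i, I i /\ x = r * a + i].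

Lemma ideal_adjoin_ideal I a : is_ideal I -> is_ideal (ideal_adjoin I a).
Proof.
move=> iI; split=> [|_ _ [r [i [Ii ->]]] [s [j [Ij ->]]]|b _ [r [i [Ii ->]]]].
- by exists 0, 0; rewrite mul0r add0r; split=> //; exact: ideal0.
- by exists (r + s), (i + j); split; [exact: ideal_add|ring].
- by exists (b * r), (b * i); split; [exact: ideal_mull|ring].
Qed.

Lemma sub_ideal_adjoin I a : I `<=` ideal_adjoin I a.
Proof. by move=> x Ix; exists 0, x; rewrite mul0r add0r. Qed.

Lemma mem_ideal_adjoin I a : is_ideal I -> ideal_adjoin I a a.
Proof. by move=> iI; exists 1, 0; split; [exact: ideal0|ring]. Qed.

Lemma neq_ideal_adjoin I a : is_ideal I -> ~ I a -> I <> ideal_adjoin I a.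
Proof. by move=> iI nIa IE; apply: nIa; rewrite IE; exact: mem_ideal_adjoin. Qed.

Definition principal_ideal a : set R := range ( *%R^~ a).

Lemma principal_ideal_ideal a : is_ideal (principal_ideal a).
Proof.
split=> [|_ _ [r _ <-] [s _ <-]|b _ [r _ <-]].
- by exists 0; rewrite ?mul0r.
- by exists (r + s); rewrite ?mulrDl.
- by exists (b * r); rewrite ?mulrA.
Qed.

Lemma mem_principal_ideal a : principal_ideal a a.
Proof. by exists 1; rewrite ?mul1r. Qed.

(** The coprimality condition of a coprime coset as a Bezout identity, so that its coefficients can
    be used in computations. *)
Definition comaximal x I : Prop := ideal_adjoin I x 1.

Lemma comaximalP x I : is_ideal I -> ideal_gen (x |` I) = setT <-> comaximal x I.
Proof.
move=> iI; split=> [xI|[r [i [Ii xI]]]].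
  have : ideal_gen (x |` I) 1 by rewrite xI.
  apply: (smallest_sub (X := ideal_adjoin I x)); first exact: ideal_adjoin_ideal.
  by move=> y [->|Iy]; [exact: mem_ideal_adjoin|exact: sub_ideal_adjoin].
apply: (idealT (ideal_gen_ideal _)).
have sub := @sub_gen_smallest _ is_ideal (x |` I).
rewrite xI; apply: (ideal_add (ideal_gen_ideal _)); last by apply: sub; right.
by apply: (ideal_mull _ (ideal_gen_ideal _)); apply: sub; left.
Qed.

Lemma comaximal_shift x i I : is_ideal I -> I i -> comaximal (x + i) I -> comaximal x I.
Proof.
move=> iI Ii [r [j [Ij e]]]; exists r, (r * i + j); split; last by rewrite e; ring.
by apply: ideal_add => //; apply: ideal_mull.
Qed.

(** Multiply the two Bezout identities: every term is a multiple of [x] except [i * j], which lies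
    in both ideals. *)
Lemma comaximalI x I J : is_ideal I -> is_ideal J ->
  comaximal x I -> comaximal x J -> comaximal x (I `&` J).
Proof.
move=> iI iJ [r [i [Ii ri]]] [s [j [Jj sj]]].
exists (r * s * x + r * j + s * i), (i * j); split.
  by split; [exact: ideal_mulr|exact: ideal_mull].
by rewrite -[LHS]mulr1 {1}ri sj; ring.
Qed.

(** Comaximality makes [x] invertible modulo [I]. *)
Lemma comaximal_cancel x a I : is_ideal I -> comaximal x I -> I (x * a) -> I a.
Proof.
move=> iI [r [i [Ii e]]] Ixa; rewrite -[a]mul1r e mulrDl -mulrA.
by apply: ideal_add => //; [exact: ideal_mull|exact: ideal_mulr].
Qed.

Lemma setI_neq0 I J : is_ideal I -> is_ideal J ->
  (exists2 x, x != 0 & I x) -> (exists2 x, x != 0 & J x) ->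
  exists2 x, x != 0 & (I `&` J) x.
Proof.
move=> iI iJ [x x0 Ix] [y y0 Jy]; exists (x * y); first by rewrite mulf_neq0.
by split; [exact: ideal_mulr|exact: ideal_mull].
Qed.

Lemma ideal_neq0P I : is_ideal I -> I <> [set 0] <-> exists2 x, x != 0 & I x.
Proof.
move=> iI; split=> [nI|[x x0 Ix] I0]; last first.
  by move: Ix x0; rewrite I0 => ->; rewrite eqxx.
apply: contra_notP nI => nx; apply/seteqP; split=> [x Ix|x ->]; last exact: ideal0.
by apply/eqP/negP => /negP x0; apply: nx; exists x.
Qed.

Lemma ideal_exp_ideal P n : is_ideal (ideal_exp P n).
Proof. by case: n => [|n]; [exact: setT_ideal|exact: ideal_gen_ideal]. Qed.

Lemma ideal_expS P n x y : P x -> ideal_exp P n y -> ideal_exp P n.+1 (x * y).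
Proof. by move=> Px Py; apply: sub_gen_smallest; exists x => //; exists y. Qed.

Lemma ideal_exp_neq0 P n : (exists2 x, x != 0 & P x) ->
  exists2 x, x != 0 & ideal_exp P n x.
Proof.
move=> [x x0 Px]; elim: n => [|n [y y0 Py]]; first by exists 1; rewrite ?oner_neq0.
by exists (x * y); [rewrite mulf_neq0|exact: ideal_expS].
Qed.

Lemma comaximal_exp x P n : comaximal x P -> comaximal x (ideal_exp P n).
Proof.
move=> [r [p [Pp rp]]]; elim: n => [|n [s [q [Pq sq]]]].
  by exists 0, 1; split=> //; ring.
exists (r * s * x + r * q + s * p), (p * q); split; first exact: ideal_expS.
by rewrite -[LHS]mulr1 {1}rp sq; ring.
Qed.

Lemma ideal_exprB I x y n : is_ideal I -> I (x - y) -> I (x ^+ n - y ^+ n).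
Proof. by move=> iI Ixy; rewrite subrXX; exact: ideal_mulr. Qed.

Lemma prime_idealX P x n : prime_ideal P -> P (x ^+ n) -> P x.
Proof.
move=> [_ P1 PM]; elim: n => [|n IHn]; first by rewrite expr0 => /P1.
by rewrite exprS => /PM[].
Qed.

Lemma prime_unit P u : prime_ideal P -> u \is a GRing.unit -> ~ P u.
Proof. by move=> [iP P1 _] uu Pu; apply: P1; rewrite -(mulVr uu); exact: ideal_mull. Qed.

Lemma prime_unitM P u x : prime_ideal P -> u \is a GRing.unit -> P (u * x) -> P x.
Proof. by move=> pP uu; case: (pP) => _ _ PM /PM[/(prime_unit pP uu)|]. Qed.

Lemma maximal_comaximal P x : maximal_ideal P -> ~ P x -> comaximal x P.
Proof.
move=> [iP P1 mP] nPx.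
have [PE|PE] := mP _ (ideal_adjoin_ideal x iP) (@sub_ideal_adjoin P x).
  by case: nPx; rewrite -PE; exact: mem_ideal_adjoin.
by rewrite /comaximal PE.
Qed.

Lemma non_prime_ideal I : is_ideal I -> ~ I 1 -> ~ prime_ideal I ->
  exists a b, [/\ ~ I a, ~ I b & I (a * b)].
Proof.
move=> iI I1 nI; apply: contra_notP nI => nab; split=> // a b Iab.
by apply: contrapT => /not_orP[Ia Ib]; apply: nab; exists a, b.
Qed.

Lemma prime_comaximal P x I : is_ideal I -> prime_ideal P -> I `<=` P ->
  comaximal x I -> ~ P x.
Proof.
move=> iI [iP P1 _] IP [r [i [Ii e]]] Px; apply: P1; rewrite e.
by apply: ideal_add => //; [exact: ideal_mull|exact: IP].
Qed.

End Ideals.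

(** * Noetherian induction and the primes over an ideal *)

Section Noetherian.
Context {R : idomainType}.
Hypothesis noethR : noetherian R.
Implicit Types (I J P Q : set R) (a b r s x y : R).

(** Otherwise every counterexample is strictly contained in another one, and dependent choice yields
    a strictly ascending chain; its union is finitely generated, which makes the chain stop. *)
Lemma noetherian_induction (Phi : set R -> Prop) :
  (forall I, is_ideal I ->
    (forall J, is_ideal J -> I `<=` J -> I <> J -> Phi J) -> Phi I) ->
  forall I, is_ideal I -> Phi I.
Proof.
move=> step I0 iI0; apply: contrapT => nI0.
pose T := {I : set R | is_ideal I /\ ~ Phi I}.
have next (I : T) : {J : T | sval I `<=` sval J /\ sval I <> sval J}.
  case: I => I [iI nI] /=; apply: cid; apply: contrapT => nJ; apply: nI.
  apply: step => // J iJ IJ neIJ; apply: contrapT => nPJ.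
  by apply: nJ; exists (exist _ J (conj iJ nPJ)).
have [f [_ fS]] := dependent_choice next (exist _ I0 (conj iI0 nI0)).
pose g n := sval (f n).
have ig n : is_ideal (g n) by rewrite /g; case: (f n) => /= ? [].
have gle m n : (m <= n)%N -> g m `<=` g n.
  by move=> /subnK <-; elim: (n - m)%N => // k IH x /IH; exact: (fS _).1.
pose U := \bigcup_n g n.
have iU : is_ideal U.
  split=> [|x y [m _ gx] [n _ gy]|a x [m _ gx]].
  - by exists 0%N => //; exact: ideal0.
  - exists (maxn m n) => //; apply: ideal_add => //.
      by apply: gle gx; exact: leq_maxl.
    by apply: gle gy; exact: leq_maxr.
  - by exists m => //; exact: ideal_mull.
have [s Us] := noethR iU.
have sU : [set` s] `<=` U by rewrite Us; exact: sub_gen_smallest.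
(* The finitely many generators of the union all lie in a single term of the chain. *)
have [N sN] : exists N, [set` s] `<=` g N.
  elim: s sU {Us} => [_|x s IH sU]; first by exists 0%N => ?.
  have [N sN] : exists N, [set` s] `<=` g N.
    by apply: IH => y ys; apply: sU; rewrite /= in_cons (ys : y \in s) orbT.
  have [M _ gM] : U x by apply: sU; rewrite /= in_cons eqxx.
  exists (maxn M N) => y /=; rewrite in_cons => /orP[/eqP ->|ys].
    by apply: gle gM; exact: leq_maxl.
  by apply: (gle _ _ (leq_maxr M N)); exact: sN.
have UN : U `<=` g N by rewrite Us; apply: smallest_sub.
case: (fS N) => _; apply; apply/seteqP; split; first exact: (fS N).1.
by move=> x gx; apply: UN; exists N.+1.
Qed.

(** If [I] is not prime, some [a * b] lies in [I] with [a] and [b] outside. Adjoining [a] or [b]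
    gives a larger proper ideal, for two Bezout identities would multiply to put 1 in [I]. *)
Lemma proper_ideal_in_prime I : is_ideal I -> ~ I 1 ->
  exists2 P, prime_ideal P & I `<=` P.
Proof.
move: I; apply: noetherian_induction => I iI IH I1.
have [pI|/(non_prime_ideal iI I1)[a [b [Ia Ib Iab]]]] := pselect (prime_ideal I).
  by exists I.
have step c : ~ I c -> ~ ideal_adjoin I c 1 -> exists2 P, prime_ideal P & I `<=` P.
  move=> Ic Ic1; have [P pP IP] := IH _ (ideal_adjoin_ideal c iI)
    (@sub_ideal_adjoin _ _ _) (neq_ideal_adjoin iI Ic) Ic1.
  by exists P => // x Ix; apply: IP; exact: sub_ideal_adjoin.
have [[r [i [Ii ei]]]|/(step _ Ia)//] := pselect (ideal_adjoin I a 1).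
have [[s [j [Ij ej]]]|/(step _ Ib)//] := pselect (ideal_adjoin I b 1).
case: I1; have -> : 1 = r * s * (a * b) + (r * a * j + (s * b + j) * i).
  by rewrite -[LHS]mulr1 {1}ei ej; ring.
by apply: ideal_add => //; [|apply: ideal_add => //]; exact: ideal_mull.
Qed.

Lemma nonunit_in_prime x : x \isn't a GRing.unit -> exists2 P, prime_ideal P & P x.
Proof.
move=> nx; have [|P pP xP] := proper_ideal_in_prime (principal_ideal_ideal x).
  by move=> [r _ rx]; case/negP: nx; apply/unitrPr; exists r; rewrite mulrC.
by exists P => //; apply: xP; exact: mem_principal_ideal.
Qed.

(** A prime containing both [y] and [I] would contain [x] as well. *)
Lemma comaximal_primes x y I : is_ideal I ->
  (forall P, prime_ideal P -> P y -> P x) -> comaximal x I -> comaximal y I.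
Proof.
move=> iI xy xI; apply: contrapT => yI.
have [P pP IP] := proper_ideal_in_prime (ideal_adjoin_ideal y iI) yI.
have IP' : I `<=` P by move=> z Iz; apply: IP; exact: sub_ideal_adjoin.
apply: (prime_comaximal iI pP IP' xI); apply: xy => //; apply: IP.
exact: mem_ideal_adjoin.
Qed.

(** Noetherian induction on nonzero ideals: if [a * b] lies in [I], each prime over [I] contains [a]
    or [b], hence lies over one of two larger ideals. *)
Lemma finite_primes_over : (forall P, prime_ideal P -> P <> [set 0] -> maximal_ideal P) ->
  forall x, x != 0 -> finite_set [set P : set R | prime_ideal P /\ P x].
Proof.
move=> dim1 x x0.
suff H I : is_ideal I -> (exists2 y, y != 0 & I y) ->
    finite_set [set P : set R | prime_ideal P /\ I `<=` P].
  apply: sub_finite_set (H _ (principal_ideal_ideal x) _).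
    move=> P [pP Px]; split=> // _ [r _ <-]; case: pP => iP _ _; exact: ideal_mull.
  by exists x => //; exact: mem_principal_ideal.
move: I; apply: noetherian_induction => I iI IH [y y0 Iy].
have [I1|I1] := pselect (I 1).
  apply: (sub_finite_set _ (finite_set0 _)) => P [[_ P1 _] IP].
  by case: P1; exact: IP.
(* A nonzero prime is maximal, hence the only prime over itself. *)
have [pI|/(non_prime_ideal iI I1)[a [b [Ia Ib Iab]]]] := pselect (prime_ideal I).
  apply: (sub_finite_set _ (finite_set1 I)) => P [[iP P1 _] IP].
  have [||_ _ mI] := dim1 I => //; first by apply/ideal_neq0P => //; exists y.
  by have [//|PT] := mI _ iP IP; case: P1; rewrite PT.
have step c : ~ I c -> finite_set [set P | prime_ideal P /\ ideal_adjoin I c `<=` P].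
  move=> Ic; apply: IH.
  - exact: ideal_adjoin_ideal.
  - exact: sub_ideal_adjoin.
  - exact: neq_ideal_adjoin.
  - by exists y => //; exact: sub_ideal_adjoin.
have := conj (step a Ia) (step b Ib); rewrite -finite_setU; apply: sub_finite_set.
move=> P [pP IP]; case: (pP) => iP _ PM; case: (PM _ _ (IP _ Iab)) => Pc; [left|right].
all: by split=> // _ [r [i [Ii ->]]]; apply: ideal_add; [|exact: ideal_mull|exact: IP].
Qed.

End Noetherian.

(** * Local divisibility from torsion in the class group *)

Section Torsion.
Context {R : idomainType}.
Hypothesis torsionR : torsion_class_group R.
Local Notation iota := (@tofrac R).
Implicit Types (P : set R) (a b r s x y : R).

(* The localization of [R] at any proper ideal is a valuation ring: if
   [(x, y)^n = (z)], then not all products of [x] or [y] with an element of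
   [(x, y)^(n-1)] lie in [P z]. *)
Lemma torsion_valuation P x y : is_ideal P -> ~ P 1 -> x != 0 -> y != 0 ->
  exists s r, ~ P s /\ (s * y = r * x \/ s * x = r * y).
Proof.
move=> iP P1 x0 y0; apply: contrapT => nsr.
pose J := [set z | exists a b, z = iota (a * x + b * y)].
have Jx : J (iota x) by exists 1, 0; congr iota; ring.
have Jy : J (iota y) by exists 0, 1; congr iota; ring.
have fJ : fractional_ideal J.
  split.
  - split=> [|_ _ [a [b ->]] [c [d ->]]|c _ [a [b ->]]].
    + by exists 0, 0; rewrite !mul0r addr0 tofrac0.
    + by exists (a + c), (b + d); rewrite -tofracD; congr iota; ring.
    + by exists (c * a), (c * b); rewrite -tofracM; congr iota; ring.
  - by move=> J0; move: Jx; rewrite J0 => /eqP; rewrite tofrac_eq0 (negPf x0).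
  - exists 1; first exact: oner_neq0.
    by move=> _ [a [b ->]]; rewrite tofrac1 mul1r; exists (a * x + b * y).
have [[//|n] _ [z z0 JnE]] := torsionR fJ.
have JnP g j : J g -> submodule_exp J n j -> exists s, g * j = iota s * z.
  move=> Jg Jj; suff : submodule_exp J n.+1 (g * j).
    by rewrite JnE => -[s _ sE]; exists s.
  by apply: sub_gen_smallest; exists g => //; exists j.
have : submodule_exp J n.+1 z by rewrite JnE; exists 1; rewrite ?tofrac1 ?mul1r.
(* Under the contrary assumption both coefficients of any relation [s * y = r * x] lie in [P], so
   the power of [J] generated by [z] falls inside [P z]. *)
have sub : submodule_exp J n.+1 `<=` [set iota p * z | p in P].
  apply: smallest_sub.
    split.
    - by exists 0; [exact: ideal0|rewrite tofrac0 mul0r].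
    - move=> _ _ [p Pp <-] [q Pq <-]; exists (p + q); first exact: ideal_add.
      by rewrite tofracD mulrDl.
    - move=> a _ [p Pp <-]; exists (a * p); first exact: ideal_mull.
      by rewrite tofracM mulrA.
  move=> _ [_ [a [b ->]] [j Jj <-]].
  have [s sE] := JnP _ _ Jx Jj.
  have [r rE] := JnP _ _ Jy Jj.
  have E : s * y = r * x.
    have [j0|j0] := eqVneq j 0.
      have H c d : iota c * j = iota d * z -> d = 0.
        move=> /esym/eqP; rewrite j0 mulr0 mulf_eq0 (negPf z0) orbF tofrac_eq0.
        by move/eqP.
      by rewrite (H _ _ sE) (H _ _ rE) !mul0r.
    apply/eqP; rewrite -tofrac_eq !tofracM; apply/eqP/(mulIf j0)/(mulIf z0).
    rewrite -(mulrA (iota s)) rE -(mulrA (iota r)) sE.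
    by rewrite !mulrA [iota s * iota r]mulrC.
  have Ps : P s by apply: contrapT => nPs; apply: nsr; exists s, r; split; [|left].
  have Pr : P r by apply: contrapT => nPr; apply: nsr; exists r, s; split; [|right].
  exists (a * s + b * r); first by apply: ideal_add; [|exact: ideal_mull|exact: ideal_mull].
  rewrite !tofracD !tofracM !mulrDl -!mulrA; congr (_ + _).
    by congr (_ * _); rewrite -sE.
  by congr (_ * _); rewrite -rE.
(* Now [z = p z] with [p] in [P], and cancelling [z] gives [p = 1]. *)
move/sub => [p Pp /eqP]; rewrite -subr_eq0 -{2}[z]mul1r -mulrBl mulf_eq0 (negPf z0).
by rewrite orbF subr_eq0 -tofrac1 tofrac_eq => /eqP p1; apply: P1; rewrite -p1.
Qed.

End Torsion.

(** * Neighbourhoods in the Golomb space, and homeomorphisms preserving primes *)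

Section GolombTopology.
Context {R : idomainType}.
Implicit Types (x y : golomb R) (A : set (golomb R)) (I J : set R).

Definition admissible x I : Prop :=
  [/\ is_ideal I, exists2 a, a != 0 & I a & comaximal (val x) I].

Lemma coprime_cosetP A : coprime_coset A <-> exists x I,
  admissible x I /\ A = [set y | I (val y - val x)].
Proof.
have E (x : golomb R) I :
    bullet [set val x + i | i in I] = [set y | I (val y - val x)].
  apply/seteqP; split=> y /=; first by move=> [i Ii <-]; rewrite addrC addKr.
  by move=> Iy; exists (val y - val x) => //; rewrite addrC subrK.
split=> -[x [I]].
  move=> [iI I0 xI ->]; exists x, I; rewrite E; split=> //.
  by split=> //; [exact/ideal_neq0P|exact/comaximalP].
move=> [[iI I0 xI] ->]; exists x, I; split=> //; first exact/ideal_neq0P.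
exact/comaximalP.
Qed.

Lemma admissible_shift x y I : admissible x I -> I (val y - val x) -> admissible y I.
Proof.
move=> [iI I0 xI] Iyx; split=> //; apply: (comaximal_shift iI (i := val x - val y)).
  by rewrite -opprB -mulN1r; exact: ideal_mull.
by rewrite addrC subrK.
Qed.

Lemma admissibleI x I J : admissible x I -> admissible x J -> admissible x (I `&` J).
Proof.
move=> [iI I0 xI] [iJ J0 xJ].
by split; [exact: setI_ideal|exact: setI_neq0|exact: comaximalI].
Qed.

(** The subbase is in fact a base: finitely many coprime cosets through [x] can be recentred at [x],
    and their intersection is the coset of the intersected ideals. *)
Lemma golomb_nbhsP x A : nbhs x A <->
  exists2 I, admissible x I & forall y, I (val y - val x) -> A y.
Proof.
rewrite nbhsE; split=> [[B [oB Bx] BA]|[I aI IA]]; last first.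
  exists [set y | I (val y - val x)] => //; split; last first.
    by rewrite /= subrr; apply: ideal0; case: aI.
  exists [set [set y | I (val y - val x)]]; last by rewrite bigcup_set1.
  move=> _ ->; apply: finI_from1; apply/coprime_cosetP; by exists x, I.
case: oB Bx BA => D' D'f <- [C D'C Cx] BA.
suff [I aI IC] : exists2 I, admissible x I & forall y, I (val y - val x) -> C y.
  by exists I => // y /IC Cy; apply: BA; exists C.
move: (D'f _ D'C) Cx {B BA} => [F FD <-] Fx.
have {FD Fx} : forall B, B \in finmap.enum_fset F -> coprime_coset B /\ B x.
  by move=> E EF; split; [have := FD E EF; rewrite inE|exact: Fx].
suff H (s : seq (set (golomb R))) : (forall B, B \in s -> coprime_coset B /\ B x) ->
    exists2 I, admissible x I &
      forall y, I (val y - val x) -> forall B, B \in s -> B y.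
  by move=> /H[I aI IF]; exists I => // y Iy B BF; exact: (IF y Iy B).
elim: s => [|B s IH] sB.
  (* The empty intersection is the coset of the unit ideal. *)
  exists setT => //; split=> //; first by exists 1; rewrite ?oner_neq0.
  by exists 0, 1; split=> //; rewrite mul0r add0r.
have [|I aI Is] := IH; first by move=> E Es; apply: sB; rewrite in_cons Es orbT.
have [/coprime_cosetP[z [J [aJ BE]]] Bx] := sB B (mem_head _ _).
move: Bx; rewrite BE => /= Jx; exists (I `&` J).
  by apply: admissibleI => //; exact: admissible_shift Jx.
move=> y [Iy Jy] E; rewrite in_cons => /orP[/eqP ->|]; last exact: Is.
case: aJ => iJ _ _.
by have := ideal_add iJ Jy Jx; rewrite addrA subrK.
Qed.

Lemma nbhs_coset x I : admissible x I -> nbhs x [set y | I (val y - val x)].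
Proof. by move=> aI; apply/golomb_nbhsP; exists I. Qed.

Lemma golomb_mul_subproof (u : unit_group R) x : val u * val x != 0.
Proof.
by rewrite mulf_neq0 ?(valP x)//; apply: contraTneq (valP u) => ->; rewrite unitr0.
Qed.

Definition golomb_mul (u : unit_group R) x : golomb R :=
  exist _ (val u * val x) (golomb_mul_subproof u x).

Lemma golomb_mul_continuous u : continuous (golomb_mul u).
Proof.
move=> x A /golomb_nbhsP[I [iI I0 uxI] IA]; apply/golomb_nbhsP; exists I => //.
  split=> //; case: uxI => r [i [Ii e]]; exists (r * val u), i; split=> //.
  by rewrite e /= mulrA.
by move=> y Iyx; apply: IA; rewrite /= -mulrBr; exact: ideal_mull.
Qed.

Lemma golomb_mulK u : cancel (golomb_mul u) (golomb_mul (unitV u)).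
Proof. by move=> x; apply: val_inj; rewrite /= mulKr// (valP u). Qed.

Lemma golomb_mulVK u : cancel (golomb_mul (unitV u)) (golomb_mul u).
Proof. by move=> x; apply: val_inj; rewrite /= mulVKr// (valP u). Qed.

Definition golomb_mul_homeo u : homeo (golomb R) :=
  Homeo (golomb_mulK u) (golomb_mulVK u)
    (@golomb_mul_continuous u) (@golomb_mul_continuous (unitV u)).

Lemma homeo_coset (h : homeo (golomb R)) x I : admissible (h x) I ->
  exists2 J, admissible x J &
    forall y, J (val y - val x) -> I (val (h y) - val (h x)).
Proof.
by move=> /nbhs_coset/(@homeo_continuous _ h x)/golomb_nbhsP[J aJ Jh]; exists J.
Qed.

Lemma LambdaP (h : homeo (golomb R)) : Lambda R h <->
  forall P x, prime_ideal P -> P (val (h x)) <-> P (val x).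
Proof.
split=> [Lh P x pP|hP P pP].
  have hP := Lh P pP; split=> [Phx|Px].
    have : bullet P (h x) by [].
    by rewrite -hP => -[y Py /(can_inj (@homeoK _ h)) <-].
  by have : bullet P (h x) by rewrite -hP; exists x.
apply/seteqP; split=> [_ [x Px <-]|x Px]; first exact/hP.
by exists (homeo_inv h x); rewrite ?homeo_invK//; apply/hP => //; rewrite homeo_invK.
Qed.

Lemma LambdaV (h : homeo (golomb R)) : Lambda R h -> Lambda R (homeoV h).
Proof.
move=> /LambdaP Lh; apply/LambdaP => P x pP.
by rewrite -(Lh P (homeoV h x) pP) /= homeo_invK.
Qed.

Lemma golomb_mul_Lambda u : Lambda R (golomb_mul_homeo u).
Proof.
apply/LambdaP => P x pP; split=> [|Px]; first exact: prime_unitM (valP u).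
by case: pP => iP _ _; exact: ideal_mull.
Qed.

Lemma Lambda_golomb_at (h : homeo (golomb R)) P x : Lambda R h -> prime_ideal P ->
  golomb_at P (h x) <-> golomb_at P x.
Proof.
move=> /LambdaP Lh pP.
by split=> -[/(Lh _ _ pP) Px xP]; split=> // Q pQ /(Lh _ _ pQ); exact: xP.
Qed.

Lemma nbhs_almost_prime x I : almost_dirichlet R -> admissible x I ->
  exists2 c : golomb R, I (val c - val x) & almost_prime (val c).
Proof.
move=> dirR aI; have [|c Ic ac] := dirR [set y | I (val y - val x)].
  by apply/coprime_cosetP; exists x, I.
by exists c.
Qed.

Lemma almost_prime_golomb_at (c : golomb R) : almost_prime (val c) ->
  exists2 P, prime_ideal P & golomb_at P c.
Proof.
by move=> [_ [P [[pP Pc] Pu]]]; exists P => //; split=> // Q pQ Qc; rewrite (Pu Q).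
Qed.

End GolombTopology.

(** * Divisibility among the elements lying in a single prime, and closures of sets of powers *)

Section Powers.
Context {R : idomainType}.
Hypothesis noethR : noetherian R.
Hypothesis torsionR : torsion_class_group R.
Implicit Types (x y : golomb R) (I J P Q : set R).

(** By [torsion_valuation] one point divides the other up to a factor [s] outside [P]. The factor
    can be removed because no prime other than [P] contains the divisor. *)
Lemma golomb_at_dvd P x y : prime_ideal P -> golomb_at P x -> golomb_at P y ->
  (exists r, val y = r * val x) \/ exists r, val x = r * val y.
Proof.
move=> pP [Px xP] [Py yP]; case: (pP) => iP P1 _.
have dvd (a b : golomb R) s r : golomb_at P a -> ~ P s ->
    s * val b = r * val a -> exists q, val b = q * val a.
  move=> [_ aP] Ps sb.
  (* The denominators of [b / a]. A prime over this ideal contains [a], so it is [P]; but the ideal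
     also contains [s], which is not in [P]. *)
  pose I := [set t | exists q, t * val b = q * val a].
  have iI : is_ideal I.
    split=> [|t t' [q e] [q' e']|t t' [q e]].
    - by exists 0; rewrite !mul0r.
    - by exists (q + q'); rewrite !mulrDl e e'.
    - by exists (t * q); rewrite -!mulrA e.
  apply: contrapT => nq; have [|Q pQ IQ] := proper_ideal_in_prime noethR iI.
    by move=> [q e]; apply: nq; exists q; rewrite -e mul1r.
  have QP : Q = P by apply: aP => //; apply: IQ; exists (val b); rewrite mulrC.
  by apply: Ps; rewrite -QP; apply: IQ; exists r.
have [s [r [Ps [sr|sr]]]] := torsion_valuation torsionR iP P1 (valP x) (valP y).
  by left; exact: dvd Ps sr.
by right; exact: dvd Ps sr.
Qed.

(** Split factors [a] off [x] one at a time. The cofactor is a unit or lies again in [P] only, and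
    if [x] divides [a], irreducibility makes them associates. *)
Lemma golomb_at_pow P (a x : golomb R) : prime_ideal P -> irreducible (val a) ->
  golomb_at P a -> golomb_at P x -> pow (val a) (val x).
Proof.
move=> pP [_ _ irra] Ga; case: (pP) => iP P1 PM.
(* The induction runs over the ideal generated by [x], which grows strictly when a factor [a] is
   removed. *)
suff H I : is_ideal I -> forall x : golomb R, I = principal_ideal (val x) ->
    golomb_at P x -> pow (val a) (val x).
  by apply: (H _ (principal_ideal_ideal (val x))).
move: I; apply: (noetherian_induction noethR) => I iI IH {}x IE Gx.
have Gnu (y : golomb R) : golomb_at P y -> val y \isn't a GRing.unit.
  by move=> [Py _]; apply/negP => /(prime_unit pP).
have [[r rE]|[r rE]] := golomb_at_dvd pP Ga Gx; last first.
  have [ur|/negPn] := irra _ _ rE; last by rewrite (negPf (Gnu _ Gx)).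
  by exists r^-1, 1%N; rewrite unitrV ur rE mulKr.
have [ur|nur] := boolP (r \is a GRing.unit); first by exists r, 1%N.
have r0 : r != 0 by apply: contraTneq (valP x) => r0; rewrite rE r0 mul0r eqxx.
have Gr : golomb_at P (exist _ r r0).
  have rx Q : prime_ideal Q -> Q r -> Q = P.
    by move=> pQ Qr; have [iQ _ _] := pQ; apply: (Gx.2 Q pQ); rewrite rE; exact: ideal_mulr.
  split=> //; have [Q pQ Qr] := nonunit_in_prime noethR nur.
  by rewrite -(rx Q).
have [|||u [n [uu n0 /= rE']]] := IH (principal_ideal r) _ _ _ (exist _ r r0) erefl Gr.
- exact: principal_ideal_ideal.
- by rewrite IE => _ [s _ <-]; exists (s * val a); rewrite // rE mulrA mulrAC.
(* If [r] and [r * a] generated the same ideal, [a] would be a unit. *)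
- move=> Ir; have : I r by rewrite Ir; exact: mem_principal_ideal.
  rewrite IE => -[s _ /eqP]; rewrite rE -subr_eq0.
  have -> : s * (r * val a) - r = (val a * s - 1) * r by ring.
  rewrite mulf_eq0 (negPf r0) orbF subr_eq0 => /eqP/(introT eqP) as1.
  by case/negP: (Gnu _ Ga); apply/unitrPr; exists s; apply/eqP.
by exists u, n.+1; split=> //; rewrite rE rE' exprSr mulrA.
Qed.

Hypothesis dirR : almost_dirichlet R.
Variable h : homeo (golomb R).
Hypothesis Lh : Lambda R h.

(* An almost prime [c] close to [h b] satisfies [golomb_at P c = pow c], a set
   preserved by [h]; since [h^-1 c] is close to [b], the image of a power of
   [b] is close to a power of [c], hence to a power of [h b]. *)
Lemma Lambda_pow_closure b y : pow (val b) (val y) ->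
  closure (bullet (pow (val (h b)))) (h y).
Proof.
move=> [u [m [uu m0 yE]]] B /golomb_nbhsP[I aI IB].
have /LambdaP LhP := Lh.
have by_ P : prime_ideal P -> P (val b) -> P (val y).
  case: m m0 yE => // m _ yE [iP _ _] Pb.
  by rewrite yE exprS mulrCA; exact: ideal_mulr.
(* Ideals admissible at [y] or [h y] are thus admissible at [b] or [h b], as every prime containing
   [b] contains [y]. *)
have adm (x z : golomb R) K : (forall P, prime_ideal P -> P (val x) -> P (val z)) ->
    admissible z K -> admissible x K.
  by move=> xz [iK K0 zK]; split=> //; exact: (comaximal_primes noethR _ xz).
have aIb : admissible (h b) I.
  by apply: adm aI => P pP /(LhP _ _ pP) /(by_ P pP) Py; exact/LhP.
have [J aJ Jh] := homeo_coset aI.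
have aJb : admissible (homeoV h (h b)) J by rewrite /= homeoK; exact: adm by_ aJ.
have [L aL Lc] := homeo_coset aJb.
have [c [Ic Jc] ac] := nbhs_almost_prime dirR (admissibleI aIb aL).
have [P pP Pc] := almost_prime_golomb_at ac.
pose c' := homeoV h c.
have Gc' : golomb_at P c' by apply/Lambda_golomb_at => //; exact: LambdaV.
have u0 : u != 0 by apply: contraTneq uu => ->; rewrite unitr0.
(* [t] is obtained from [h^-1 c] as [y] is from [b]. It lies in [P] only, so [h t] has the form
   [w * c ^+ k]; replacing [c] by [h b] gives the required point of the closure. *)
pose t : golomb R := exist _ (u * val c' ^+ m) (mulf_neq0 u0 (expf_neq0 m (valP c'))).
have Gt : golomb_at P t.
  case: Gc' (pP) => Pc' c'P [iP _ _]; split=> /=.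
    by case: (m) m0 => // k _; rewrite exprS mulrCA; exact: ideal_mulr.
  by move=> Q pQ /(prime_unitM pQ uu)/(prime_idealX pQ); exact: c'P.
have [w [k [uw k0 ht]]] : pow (val c) (val (h t)).
  by apply: (golomb_at_pow pP ac.1 Pc); apply/Lambda_golomb_at.
have iI : is_ideal I by case: aI.
have iJ : is_ideal J by case: aJ.
have w0 : w != 0 by apply: contraTneq uw => ->; rewrite unitr0.
exists (exist _ (w * val (h b) ^+ k) (mulf_neq0 w0 (expf_neq0 k (valP (h b))))).
split; first by exists w, k.
apply: IB => /=.
have It : I (val (h t) - val (h y)).
  apply: Jh; rewrite /= yE -mulrBr; apply: ideal_mull => //; apply: ideal_exprB => //.
  by have := Lc _ Jc; rewrite /= homeoK.
have Iw : I (w * (val c ^+ k - val (h b) ^+ k)).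
  by apply: ideal_mull => //; exact: ideal_exprB.
by have := ideal_sub iI It Iw; rewrite ht mulrBr opprB addrC addrA subrK.
Qed.

End Powers.

(** * Rigidity of the homeomorphisms preserving primes *)

Section Rigidity.
Context {R : idomainType}.
Implicit Types (x y : golomb R) (I J L P Q : set R) (h : homeo (golomb R)).

Lemma residue_class_eq I (a b : R) : is_ideal I -> I (a - b) ->
  residue_class I a = residue_class I b.
Proof.
move=> iI Iab; apply/seteqP; split=> t /= It.
  by have := ideal_add iI It Iab; rewrite addrA subrK.
by have := ideal_sub iI It Iab; rewrite opprB addrA subrK.
Qed.

(* Since [t] lies in [J] and is invertible modulo [L], the ideals [J] and [L]
   are comaximal. *)
Lemma coset_meet x (t : golomb R) J L :
  admissible x J -> admissible t L -> J (val t) ->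
  exists2 z : golomb R, J (val z - val x) & L (val z - val t).
Proof.
move=> [iJ J0 _] [iL L0 [r [l [Ll e]]]] Jt.
have [a a0 [Ja La]] := setI_neq0 iJ iL J0 L0.
have [z z0 [Jz Lz]] : exists2 z, z != 0 & J (z - val x) /\ L (z - val t).
  pose z := l * val x + r * val t * val t.
  have lE : l = 1 - r * val t by rewrite e addrC addKr.
  have Jz : J (z - val x).
    have -> : z - val x = (r * (val t - val x)) * val t by rewrite /z lE; ring.
    exact: ideal_mull.
  have Lz : L (z - val t).
    have -> : z - val t = (val x - val t) * l.
      by rewrite /z lE; ring.
    exact: ideal_mull.
  have [z0|z0] := eqVneq z 0; last by exists z.
  exists a => //; move: Jz Lz; rewrite z0 => Jz Lz.
  by split; rewrite -[a]addr0 -addrA; apply: ideal_add.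
by exists (exist _ z z0).
Qed.

(** Evaluation at 1 recovers the unit. *)
Lemma golomb_mul_homeo_inj : injective (@golomb_mul_homeo R).
Proof.
move=> u v /(congr1 (fun h : homeo (golomb R) => val (h golomb1))) /=.
by rewrite !mulr1 => uv; apply: val_inj.
Qed.

Lemma golomb_mul_homeoM (u v : unit_group R) :
  golomb_mul_homeo (u * v)%g = (golomb_mul_homeo u * golomb_mul_homeo v)%g.
Proof. by apply: homeoP => x; apply: val_inj; rewrite /= mulrA. Qed.

Hypothesis dedekindR : dedekind_domain R.
Hypothesis torsionR : torsion_class_group R.
Hypothesis dirichletR : almost_dirichlet R.
Hypothesis separatedR : power_separated R.
Hypothesis infinite_inj : infinite_set [set P : set R | prime_ideal P /\
  exists2 n, (0 < n)%N &
    {in @GRing.unit R &, injective (residue_class (ideal_exp P n))}].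

Let noethR : noetherian R. Proof. by case: dedekindR. Qed.

Let maximalP P (a : R) : prime_ideal P -> a != 0 -> P a -> maximal_ideal P.
Proof.
case: dedekindR => _ _ dim1 _ pP a0 Pa; apply: dim1 => //.
by case: (pP) => iP _ _; apply/ideal_neq0P => //; exists a.
Qed.

(** Only finitely many primes contain [a], so the infinite family has a nonzero member avoiding it.
    This supplies the modulus that detects units as well as maximal ideals separating points. *)
Lemma unit_injective_prime (a : R) : a != 0 -> exists P n,
  [/\ prime_ideal P, P <> [set 0], maximal_ideal P, ~ P a &
    {in @GRing.unit R &, injective (residue_class (ideal_exp P n))}].
Proof.
move=> a0; case: dedekindR => _ _ dim1 _; apply: contrapT => nP; apply: infinite_inj.
have := conj (finite_primes_over noethR dim1 a0) (finite_set1 [set 0 : R]).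
rewrite -finite_setU; apply: sub_finite_set => P [pP [n n0 Pn]].
have [->|P0] := pselect (P = [set 0]); first by right.
left; split=> //; apply: contrapT => Pa; apply: nP; exists P, n; split=> //.
exact: dim1.
Qed.

Lemma admissible_maximal x P : maximal_ideal P -> P <> [set 0] -> ~ P (val x) ->
  admissible x P.
Proof.
move=> mP P0 Px; case: (mP) => iP _ _; split=> //; first exact/ideal_neq0P.
exact: maximal_comaximal.
Qed.

Lemma admissible_exp x P n : admissible x P -> admissible x (ideal_exp P n).
Proof.
move=> [iP P0 xP]; split; first exact: ideal_exp_ideal.
  exact: ideal_exp_neq0.
exact: comaximal_exp.
Qed.

(** With [y = h^-1 c], a power of [c] up to a unit, the closure lemma puts [c = h y] in the closure
    of [pow (h c)]. Power separation makes [c] a unit times a power of [h c], and irreducibility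
    makes the two associates. *)
Lemma Lambda_almost_prime h (c : golomb R) : Lambda R h -> almost_prime (val c) ->
  exists u : unit_group R, h c = golomb_mul u c.
Proof.
move=> Lh ac; have [P pP Gc] := almost_prime_golomb_at ac.
have Ghc : golomb_at P (h c) by apply/Lambda_golomb_at.
pose y := homeoV h c.
have Gy : golomb_at P y by apply/Lambda_golomb_at => //; exact: LambdaV.
have : closure (bullet (pow (val (h c)))) (h y).
  apply: Lambda_pow_closure => //.
  exact: (golomb_at_pow noethR torsionR pP ac.1 Gc Gy).
rewrite /= homeo_invK => clc.
have : (closure (bullet (pow (val (h c)))) `&` golomb_at P) c by [].
rewrite separatedR//; last by apply: (maximalP pP (valP c)); case: Gc.
move=> [u [[|n] [uu n0]]] //; rewrite exprSr mulrA => cE.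
case: ac.1 => _ _ /(_ _ _ cE)[uv|/(prime_unit pP)]; last by case: Ghc.
have uv' := uv; rewrite -unitrV in uv'.
by exists (exist (fun v => v \is a GRing.unit) _ uv'); apply: val_inj; rewrite /= cE mulKr.
Qed.

Lemma Lambda_local h x : Lambda R h -> exists (u : unit_group R) J,
  admissible x J /\ forall y, J (val y - val x) -> h y = golomb_mul u y.
Proof.
move=> Lh; have [Q [n [pQ Q0 mQ Qx injQ]]] := unit_injective_prime (valP x).
have /LambdaP LhP := Lh.
pose I := ideal_exp Q n.
have iI : is_ideal I by exact: ideal_exp_ideal.
have aI : admissible x I by exact/admissible_exp/admissible_maximal.
have [|J1 aJ1 J1h] := @homeo_coset _ h x I.
  by apply/admissible_exp/admissible_maximal => // /(LhP _ _ pQ).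
have aJ := admissibleI aJ1 aI; set J := J1 `&` I in aJ.
(* The unit attached to an almost prime near [x] sends [x] to [h x] modulo [Q^n]. Since [x] is
   invertible there, any two such units agree modulo [Q^n], hence are equal. *)
have Jmul (c : golomb R) (u : unit_group R) : J (val c - val x) ->
    h c = golomb_mul u c -> I (val u * val x - val (h x)).
  move=> [/J1h J1c Ic] hc; move: J1c; rewrite hc /= => J1c.
  suff -> : val u * val x - val (h x) =
      (val u * val c - val (h x)) - val u * (val c - val x).
    by apply: ideal_sub => //; exact: ideal_mull.
  ring.
have [c0 Jc0 ac0] := nbhs_almost_prime dirichletR aJ.
have [u hc0] := Lambda_almost_prime Lh ac0.
have huJ (c : golomb R) : J (val c - val x) -> almost_prime (val c) ->
    h c = golomb_mul u c.
  move=> Jc ac; have [v hc] := Lambda_almost_prime Lh ac; rewrite hc.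
  suff -> : v = u by [].
  apply: val_inj; apply: injQ; rewrite ?(valP u) ?(valP v)//; apply: residue_class_eq => //.
  case: aI => _ _ xI; apply: (comaximal_cancel iI xI).
  suff -> : val x * (val v - val u) =
      (val v * val x - val (h x)) - (val u * val x - val (h x)).
    by apply: ideal_sub; [|exact: Jmul hc|exact: Jmul hc0].
  ring.
(* Hausdorff argument: if [h y] and [u y] differ, take a maximal ideal [M] containing neither [y]
   nor their difference. An almost prime [c] near [y] has [h c = u c], close modulo [M] to both, so
   [M] contains the difference after all. *)
exists u, J; split=> // y Jy; apply: contrapT => hyu.
have d0 : val (h y) - val u * val y != 0.
  by rewrite subr_eq0; apply/eqP => e; apply: hyu; exact: val_inj.
have [M [_ [pM M0 mM Myd _]]] := unit_injective_prime (mulf_neq0 (valP y) d0).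
have iM : is_ideal M by case: pM.
have My : ~ M (val y) by move=> My; apply: Myd; exact: ideal_mulr.
have [|K1 aK1 hK1] := @homeo_coset _ h y M.
  by apply: admissible_maximal => // /(LhP _ _ pM).
have [|K2 aK2 uK2] := @homeo_coset _ (golomb_mul_homeo u) y M.
  by apply: admissible_maximal => //= /(prime_unitM pM (valP u)).
have aK := admissibleI (admissible_shift aJ Jy) (admissibleI aK1 aK2).
have [c [Jc [K1c K2c]] ac] := nbhs_almost_prime dirichletR aK.
have Jcx : J (val c - val x).
  by case: aJ => iJ _ _; have := ideal_add iJ Jc Jy; rewrite addrA subrK.
apply: Myd; apply: ideal_mull => //.
have := ideal_sub iM (uK2 _ K2c) (hK1 _ K1c).
by rewrite (huJ _ Jcx ac) /= opprB addrC addrA subrK.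
Qed.

(** The local units at 1 and at [x] are both compared with the one at an auxiliary point whose
    neighbourhoods meet the cosets of both. *)
Lemma Lambda_mul h : Lambda R h -> exists u : unit_group R, h = golomb_mul_homeo u.
Proof.
move=> Lh; have [u [J [aJ hJ]]] := Lambda_local golomb1 Lh.
exists u; apply: homeoP => x; have [v [K [aK hK]]] := Lambda_local x Lh.
have [[iJ J0 _] [iK K0 xK]] := (aJ, aK).
(* A nonzero [t] in both [J] and [K]: by [coset_meet] any admissible coset of [t] meets [1 + J] and
   [x + K]. *)
have [t t0 [Jt Kt]] := setI_neq0 iJ iK J0 K0.
pose T : golomb R := exist _ t t0.
have [w [L [aL hL]]] := Lambda_local T Lh.
have eqw (u1 u2 : unit_group R) (z : golomb R) :
    h z = golomb_mul u1 z -> h z = golomb_mul u2 z -> u1 = u2.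
  by move=> -> /(congr1 val)/(mulIf (valP z)) uv; exact: val_inj.
have [z Jz Lz] := coset_meet aJ aL (Jt : J (val T)).
have [z' Kz' Lz'] := coset_meet aK aL (Kt : K (val T)).
rewrite (eqw _ _ _ (hJ _ Jz) (hL _ Lz)) -(eqw _ _ _ (hK _ Kz') (hL _ Lz')).
by apply: hK; rewrite subrr; exact: ideal0.
Qed.

End Rigidity.

Theorem proposition7p4 (R : idomainType)
    (dedekindR : dedekind_domain R) (torsionR : torsion_class_group R)
    (dirichletR : almost_dirichlet R) (separatedR : power_separated R)
    (infinite_inj : infinite_set [set P : set R | prime_ideal P /\
       exists2 n, (0 < n)%N &
         {in @GRing.unit R &, injective (residue_class (ideal_exp P n))}]) :
  Lambda1 R = [set 1%g] /\ group_isomorphic (Lambda_group R) (unit_group R).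
Proof.
have mulE := Lambda_mul dedekindR torsionR dirichletR separatedR infinite_inj.
split.
  apply/seteqP; split=> [h [/mulE[u ->] u1]|_ ->]; last first.
    by split=> //; apply/LambdaP.
  (* Fixing 1 forces the unit to be 1. *)
  apply: homeoP => x; apply: val_inj; move: u1 => /(congr1 val) /=.
  by rewrite mulr1 => ->; rewrite mul1r.
have /choice[f fE] (h : Lambda_group R) :
    exists u : unit_group R, val h = golomb_mul_homeo u.
  by apply: mulE; exact: set_mem (valP h).
(* The unit of [h] is merely chosen; its uniqueness makes the choice multiplicative. *)
have fM : {morph f : h k / (h * k)%g}.
  move=> h k; apply: golomb_mul_homeo_inj.
  by rewrite golomb_mul_homeoM -!fE.
pose F : {multiplicative Lambda_group R -> unit_group R} :=
  HB.pack f (isMultiplicative.Build _ _ f fM).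
exists F, (fun u => exist _ (golomb_mul_homeo u) (mem_set (golomb_mul_Lambda u))).
  by move=> h; apply: val_inj; rewrite /= -fE.
by move=> u; apply: golomb_mul_homeo_inj; rewrite /= -fE.
Qed.
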